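(* Let $A \in \operatorname{Pd}(2n)$, with distinct symplectic eigenvalues $\mu_1<\cdots<\mu_r$ and associated index sets $\alpha_i,\beta_i,\gamma_i$ ($1\le i\le r$), and let $H\in \operatorname{Sm}(2n)$ be such that $A + H \in \operatorname{Pd}(2n)$. Let $S\in \operatorname{Sp}(2n; A)$ and $\tilde{S} \in \operatorname{Sp}(2n; A+H)$. Then for $1\leq i\neq j\leq r$ we have \begin{align*} \left(S^{-1}\tilde{S}\right)_{\gamma_i \gamma_j} &=\mathcal{O}(\|H \|), \\ \left(S^{-1}\tilde{S}\right)_{\alpha_i \alpha_i} &=\left(S^{-1}\tilde{S}\right)_{\beta_i \beta_i} + \mathcal{O}(\|H \|), \\ \left(S^{-1}\tilde{S}\right)_{\alpha_i \beta_i} &=-\left(S^{-1}\tilde{S}\right)_{\beta_i \alpha_i} + \mathcal{O}(\|H \|), \\ \left(S^{-1}\tilde{S}\right)_{\gamma_i \gamma_i}^T \left(S^{-1}\tilde{S}\right)_{\gamma_i \gamma_i} &= I_{2|\alpha_i|} + \mathcal{O}(\|H\|),\\ \left(S^{-1}\tilde{S}\right)_{\gamma_i \gamma_i}^T J_{2|\alpha_i|} \left(S^{-1}\tilde{S}\right)_{\gamma_i \gamma_i} &= J_{2|\alpha_i|} + \mathcal{O}(\|H\|^2). \end{align*} (The last four relations involve only $i$ and are asserted for every $i=1,\ldots,r$.)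
   Context: Notation. $\operatorname{Sm}(m)$ is the set of $m\times m$ real symmetric matrices; $\operatorname{Pd}(2n)\subset\operatorname{Sm}(2n)$ is the set of positive definite ones. $\|\cdot\|$ is the spectral norm (maximum singular value). $I_n$ is the $n\times n$ identity matrix and $J_{2n}=\begin{pmatrix}0&I_n\\-I_n&0\end{pmatrix}$. A real $2n\times 2n$ matrix $S$ is symplectic if $S^TJ_{2n}S=J_{2n}$; $\operatorname{Sp}(2n)$ is the group of such matrices. Williamson's theorem: for every $A\in\operatorname{Pd}(2n)$ there is $S\in\operatorname{Sp}(2n)$ with $S^TAS=D\oplus D=\begin{pmatrix}D&0\\0&D\end{pmatrix}$, where $D$ is an $n\times n$ diagonal matrix with positive diagonal entries $d_1(A)\le\cdots\le d_n(A)$ (listed in this order), which do not depend on $S$ and are called the symplectic eigenvalues of $A$. $\operatorname{Sp}(2n;A)$ is the set of all $S\in\operatorname{Sp}(2n)$ with $S^TAS=D\oplus D$ for this $D=\operatorname{diag}(d_1(A),\ldots,d_n(A))$. Index sets: if $\mu_1<\cdots<\mu_r$ are the distinct symplectic eigenvalues of $A$, then for $i=1,\ldots,r$, $\alpha_i=\{j\in\{1,\ldots,n\}: d_j(A)=\mu_i\}$, $\beta_i=\{j+n: j\in\alpha_i\}$, $\gamma_i=\alpha_i\cup\beta_i$. For a matrix $M$ and index sets $\mathcal I,\mathcal J$, $M_{\mathcal I\mathcal J}$ is the $|\mathcal I|\times|\mathcal J|$ submatrix of entries $M_{ij}$ with $i\in\mathcal I$, $j\in\mathcal J$ (indices in increasing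 order). Big-O: for $p\in\{1,2\}$, $Y=\mathcal O(\|H\|^p)$ means that there exist positive scalars $c$ and $\delta$ such that $\|Y\|\le c\|H\|^p$ for all admissible $H$ (i.e. $H\in \operatorname{Sm}(2n)$ with $A+H\in\operatorname{Pd}(2n)$) with $\|H\|<\delta$. Here $A$ and $S$ are fixed, $H$ varies, and $\tilde S$ is an arbitrary element of $\operatorname{Sp}(2n;A+H)$ for each $H$. *)

(* Defs.v *)
From HB Require Import structures.
From mathcomp Require Import all_boot all_order all_algebra.
From mathcomp Require Import boolp classical_sets reals.

Set Implicit Arguments.
Unset Strict Implicit.
Unset Printing Implicit Defensive.

Import Order.TTheory GRing.Theory Num.Theory.
Local Open Scope ring_scope.
Local Open Scope classical_set_scope.

(* Maximum singular value. The set is finite, and nonempty unless k = 0, so the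
   supremum is a maximum; for k = 0 it is [sup set0 = 0]. When m < k, the zero
   eigenvalues of M^T M in excess of the min(m, k) singular values do not
   affect the maximum. *)
Definition specnorm (R : realType) (m k : nat) (M : 'M[R]_(m, k)) : R :=
  sup [set s : R | 0 <= s /\ eigenvalue (M^T *m M) (s ^+ 2)].

Definition Sm (R : realType) (m : nat) : set 'M[R]_m :=
  [set A | A \is symmetricmx].

Definition Pd (R : realType) (m : nat) : set 'M[R]_m :=
  [set A | Sm A /\
     forall x : 'cV[R]_m, x != 0 -> 0 < (x^T *m A *m x) 0 0].

Definition Jmx (R : realType) (n : nat) : 'M[R]_(n + n) :=
  block_mx 0 1%:M (- 1%:M) 0.

Definition Sp (R : realType) (n : nat) : set 'M[R]_(n + n) :=
  [set S | S^T *m Jmx R n *m S = Jmx R n].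

Definition diag_double (R : realType) (n : nat) (d : 'rV[R]_n) :
    'M[R]_(n + n) :=
  block_mx (diag_mx d) 0 0 (diag_mx d).

Definition williamson (R : realType) (n : nat) (A : 'M[R]_(n + n))
    (d : 'rV[R]_n) : Prop :=
  [/\ forall j, 0 < d 0 j,
      forall j k : 'I_n, (j <= k)%N -> d 0 j <= d 0 k &
      exists2 S, Sp S & S^T *m A *m S = diag_double d].

(* For [Pd A], Williamson's theorem says that exactly one [d] satisfies
   [williamson A d]; [xget] selects it. The default 0 only matters when there
   is no such [d]. *)
Definition symp_eigs (R : realType) (n : nat) (A : 'M[R]_(n + n)) : 'rV[R]_n :=
  xget 0 [set d | williamson A d].

Definition SpA (R : realType) (n : nat) (A : 'M[R]_(n + n)) :
    set 'M[R]_(n + n) :=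
  [set S | Sp S /\ S^T *m A *m S = diag_double (symp_eigs A)].

Definition eig_class (R : realType) (n : nat) (A : 'M[R]_(n + n)) (x : R) :
    {set 'I_n} :=
  [set j | symp_eigs A 0 j == x]%SET.

(* Index sets inside {0, .., 2n-1}: [lshift n j] has value j and [rshift n j]
   has value n + j. *)
Definition alpha (R : realType) (n : nat) (A : 'M[R]_(n + n)) (x : R) :
    {set 'I_(n + n)} := (lshift n @: eig_class A x)%SET.

Definition beta (R : realType) (n : nat) (A : 'M[R]_(n + n)) (x : R) :
    {set 'I_(n + n)} := (@rshift n n @: eig_class A x)%SET.

Definition gamma (R : realType) (n : nat) (A : 'M[R]_(n + n)) (x : R) :
    {set 'I_(n + n)} := (alpha A x :|: beta A x)%SET.

Lemma card_beta (R : realType) (n : nat) (A : 'M[R]_(n + n)) (x : R) :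
  #|beta A x| = #|alpha A x|.
Proof.
by rewrite !card_imset //; [exact: lshift_inj | exact: rshift_inj].
Qed.

Lemma card_gamma (R : realType) (n : nat) (A : 'M[R]_(n + n)) (x : R) :
  #|gamma A x| = (#|alpha A x| + #|alpha A x|)%N.
Proof.
rewrite cardsU card_beta [X in (_ - X)%N](_ : _ = 0)%N ?subn0 //.
apply/eqP; rewrite cards_eq0; apply/eqP/setP => k; rewrite !inE.
apply/negP => /andP[/imsetP[a _ ->] /imsetP[b _ /eqP]].
by rewrite eq_lrshift.
Qed.

(* [enum_val] lists an index set of ordinals in increasing order. *)
Definition submatrix (R : realType) (m k : nat) (M : 'M[R]_(m, k))
    (I : {set 'I_m}) (K : {set 'I_k}) : 'M[R]_(#|I|, #|K|) :=
  mxsub (fun a : 'I_#|I| => enum_val a) (fun b : 'I_#|K| => enum_val b) M.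

(* The blocks at alpha and beta, retyped so that they have the same
   dimensions, and the gamma-gamma block with its size written as
   2 |alpha|. *)
Definition sub_aa (R : realType) (n : nat) (A M : 'M[R]_(n + n)) (x : R) :
    'M[R]_#|alpha A x| :=
  submatrix M (alpha A x) (alpha A x).

Definition sub_ab (R : realType) (n : nat) (A M : 'M[R]_(n + n)) (x : R) :
    'M[R]_#|alpha A x| :=
  castmx (erefl, card_beta A x) (submatrix M (alpha A x) (beta A x)).

Definition sub_ba (R : realType) (n : nat) (A M : 'M[R]_(n + n)) (x : R) :
    'M[R]_#|alpha A x| :=
  castmx (card_beta A x, erefl) (submatrix M (beta A x) (alpha A x)).

Definition sub_bb (R : realType) (n : nat) (A M : 'M[R]_(n + n)) (x : R) :
    'M[R]_#|alpha A x| :=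
  castmx (card_beta A x, card_beta A x) (submatrix M (beta A x) (beta A x)).

Definition sub_gg (R : realType) (n : nat) (A M : 'M[R]_(n + n)) (x : R) :
    'M[R]_(#|alpha A x| + #|alpha A x|) :=
  castmx (card_gamma A x, card_gamma A x)
    (submatrix M (gamma A x) (gamma A x)).

(* [Y H S'] = O(||H||^p) at the fixed matrix [A]: c and delta are uniform over
   the admissible H and over all S' in Sp(2n; A + H). *)
Definition bigO_pert (R : realType) (n : nat) (A : 'M[R]_(n + n)) (p : nat)
    (m k : nat) (Y : 'M[R]_(n + n) -> 'M[R]_(n + n) -> 'M[R]_(m, k)) : Prop :=
  exists c delta : R, [/\ 0 < c, 0 < delta &
    forall H S' : 'M[R]_(n + n),
      Sm H -> Pd (A + H) -> specnorm H < delta -> SpA (A + H) S' ->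
      specnorm (Y H S') <= c * specnorm H ^+ p].

(* Main.v *)
Require Import Defs.
From HB Require Import structures.
From mathcomp Require Import all_boot all_order all_algebra.
From mathcomp Require Import boolp classical_sets reals.
From mathcomp Require Import ring lra.
From mathcomp Require Import complex.

Set Implicit Arguments.
Unset Strict Implicit.
Unset Printing Implicit Defensive.

Import Order.TTheory GRing.Theory Num.Theory.
Local Open Scope ring_scope.

(** Let L be the doubled diagonal matrix of the symplectic eigenvalues d of A,
    L' that of the eigenvalues d' of A + H, and put M = S^-1 S' and
    E = S^T H S, which is O(||H||). Then M is symplectic and
    M^T (L + E) M = L'. Since M J M^T = J, this congruence turns into the
    linear relation J (L + E) M = M J L'.

    Eigenvalues first. A symplectic counterpart of the Courant-Fischer principle
    ([symplectic_form_le_eig]) shows that an inequality between the forms of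
    L and L' along a symplectic change of variables passes to the ordered
    symplectic eigenvalues. As E is small relative to L, it gives
    d' - d = O(||H||) ([symplectic_eig_pert], [isO_eig]), and positivity of L
    then bounds M ([transition_bounded]).

    Consequently M commutes with K = J L up to O(||H||) ([isO_commutator]),
    hence also with K^2 = - L^2, whose entries single out the eigenvalues: an
    entry of M joining two different eigenvalues is O(||H||)
    ([isO_offdiag]). Within one eigenvalue x the matrix K is x J, so there
    M commutes with J up to O(||H||), and altogether J M - M J = O(||H||)
    ([isO_commJ]). The relations between the alpha and beta blocks are
    entries of this commutator. Inserting it into M^T J M = J yields
    M^T M = I + O(||H||) ([isO_gram]).

    The products of the gamma blocks differ from the corresponding blocks of
    M^T M and M^T J M only by terms containing two entries of M that join
    different eigenvalues, each O(||H||). For M^T J M, which is exactly J,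
    this leaves an error O(||H||^2).

    All estimates are carried out on entries; [specnorm_le] and
    [entry_le_specnorm] translate between entries and the spectral norm. *)

(** * Spectral norm and matrix entries *)

Lemma eigenvalue_mulmx_trE (R : realType) (m k : nat) (M : 'M[R]_(m, k))
    (v : 'rV[R]_k) (a : R) :
  v *m (M^T *m M) = a *: v ->
  \sum_i (M *m v^T) i 0 ^+ 2 = a * \sum_j v 0 j ^+ 2.
Proof.
move=> vM.
have /(congr1 (fun X : 'M_1 => X 0 0)) :
    (M *m v^T)^T *m (M *m v^T) = a *: (v *m v^T).
  by rewrite trmx_mul trmxK scalemxAl -vM !mulmxA.
rewrite !mxE mulr_sumr => E; apply: etrans (etrans E _).
  by apply: eq_bigr => i _; rewrite [in RHS]mxE expr2.
by rewrite mulr_sumr; apply: eq_bigr => j _; rewrite !mxE expr2.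
Qed.

Lemma sum_sqr_gt0 (R : realType) (I : finType) (f : I -> R) (i : I) :
  f i != 0 -> 0 < \sum_j f j ^+ 2.
Proof.
move=> fi; rewrite (bigD1 i) //=; apply: ltr_pwDl.
  by rewrite exprn_even_gt0.
by apply: sumr_ge0 => j _; exact: sqr_ge0.
Qed.

Lemma row_neq0_entry (R : realType) (k : nat) (v : 'rV[R]_k) :
  v != 0 -> exists j, v 0 j != 0.
Proof.
move=> v0; apply/existsP; apply: contraR v0 => /existsPn v0.
by apply/eqP/rowP => j; rewrite mxE; apply/eqP; have := v0 j; rewrite negbK.
Qed.

(** Both factors are at most the square root of the sum. *)
Lemma sqr_sum_abs_le (R : realType) (I : finType) (f : I -> R) (i j : I) :
  `|f i * f j| <= \sum_l f l ^+ 2.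
Proof.
have le1 l : f l ^+ 2 <= \sum_p f p ^+ 2.
  rewrite (bigD1 l) //= lerDl.
  by apply: sumr_ge0 => p _; exact: sqr_ge0.
have := le1 i; have := le1 j; rewrite normrM.
rewrite -(real_normK (num_real (f i))) -(real_normK (num_real (f j))).
nra.
Qed.

Lemma mulmx_sum_sqr_le (R : realType) (m k : nat) (M : 'M[R]_(m, k)) (b : R)
    (v : 'rV[R]_k) :
  0 <= b -> (forall i j, `|M i j| <= b) ->
  \sum_i (M *m v^T) i 0 ^+ 2 <= (m * k ^ 2)%:R * b ^+ 2 * \sum_j v 0 j ^+ 2.
Proof.
move=> b0 Mb; set N := \sum_j v 0 j ^+ 2.
suff Q i : (M *m v^T) i 0 ^+ 2 <= (k ^ 2)%:R * b ^+ 2 * N.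
  apply: (@le_trans _ _ (\sum_(i < m) (k ^ 2)%:R * b ^+ 2 * N)).
    by apply: ler_sum => i _; exact: Q.
  by rewrite sumr_const card_ord natrM -[leLHS]mulr_natl !mulrA.
rewrite mxE expr2 big_distrlr /=.
apply: (@le_trans _ _ (\sum_(j < k) \sum_(l < k) b ^+ 2 * N)); last first.
  rewrite sumr_const card_ord sumr_const card_ord -mulrnA -mulnn.
  by rewrite -[leLHS]mulr_natl mulrA.
apply: ler_sum => j _; apply: ler_sum => l _; rewrite !mxE.
have -> : M i j * v 0 j * (M i l * v 0 l) = (M i j * M i l) * (v 0 j * v 0 l).
  by ring.
apply: le_trans (ler_norm _) _; rewrite normrM.
apply: ler_pM => //; last exact: (sqr_sum_abs_le (fun j => v 0 j)).
by rewrite normrM expr2; apply: ler_pM.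
Qed.

Lemma singular_value_le (R : realType) (m k : nat) (M : 'M[R]_(m, k))
    (b s : R) :
  0 <= b -> (forall i j, `|M i j| <= b) ->
  0 <= s -> eigenvalue (M^T *m M) (s ^+ 2) -> s <= (m * k ^ 2).+1%:R * b.
Proof.
move=> b0 Mb s0 /eigenvalueP [v vM /row_neq0_entry [j vj]].
have := mulmx_sum_sqr_le v b0 Mb.
rewrite (eigenvalue_mulmx_trE vM) ler_pM2r; last exact: (sum_sqr_gt0 (i := j)).
move=> le1; rewrite -(ler_pXn2r (n := 2)) // ?nnegrE ?mulr_ge0 //.
apply: (le_trans le1); rewrite exprMn ler_wpM2r ?sqr_ge0 //.
by rewrite -natrX ler_nat; apply: leq_trans (leqnSn _) _; rewrite leq_pmulr.
Qed.

(** The constant is not sharp: comparing norms up to a factor that depends only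
    on the dimensions is enough for asymptotic estimates. *)
Lemma specnorm_le (R : realType) (m k : nat) (M : 'M[R]_(m, k)) (b : R) :
  0 <= b -> (forall i j, `|M i j| <= b) ->
  specnorm M <= (m * k ^ 2).+1%:R * b.
Proof.
move=> b0 Mb; rewrite /specnorm.
have [ne|/set0P/negP] := pselect ([set s : R | 0 <= s /\
    eigenvalue (M^T *m M) (s ^+ 2)] !=set0)%classic.
  by apply: ge_sup => // s [s0]; exact: singular_value_le.
by rewrite negbK => /eqP ->; rewrite sup0 mulr_ge0.
Qed.

Lemma has_ubound_singular_values (R : realType) (m k : nat)
    (M : 'M[R]_(m, k)) :
  has_ubound [set s : R | 0 <= s /\ eigenvalue (M^T *m M) (s ^+ 2)]%classic.
Proof.
pose b := \sum_i \sum_j `|M i j|.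
have b0 : 0 <= b by apply: sumr_ge0 => i _; apply: sumr_ge0.
exists ((m * k ^ 2).+1%:R * b) => s [s0]; apply: singular_value_le => // i j.
rewrite /b (bigD1 i) //= (bigD1 j) //= -addrA lerDl addr_ge0 ?sumr_ge0 //.
by move=> p _; rewrite sumr_ge0.
Qed.

Lemma specnorm_ge0 (R : realType) (m k : nat) (M : 'M[R]_(m, k)) :
  0 <= specnorm M.
Proof.
rewrite /specnorm; have [[s Es]|/set0P/negP] := pselect ([set s : R | 0 <= s /\
    eigenvalue (M^T *m M) (s ^+ 2)] !=set0)%classic.
  by apply: le_trans (ub_le_sup (has_ubound_singular_values M) Es); case: Es.
by rewrite negbK => /eqP ->; rewrite sup0.
Qed.

Lemma eigenvalue_le_specnorm (R : realType) (m k : nat) (M : 'M[R]_(m, k))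
    (a : R) :
  eigenvalue (M^T *m M) a -> a <= specnorm M ^+ 2.
Proof.
move=> ea; have a0 : 0 <= a.
  have /eigenvalueP [v vM /row_neq0_entry [j vj]] := ea.
  have := sum_sqr_gt0 vj; have := eigenvalue_mulmx_trE vM => e gt0.
  by rewrite -(pmulr_lge0 _ gt0) -e sumr_ge0 // => i _; exact: sqr_ge0.
rewrite -(sqr_sqrtr a0) ler_pXn2r ?nnegrE ?sqrtr_ge0 ?specnorm_ge0 //.
apply: ub_le_sup; first exact: has_ubound_singular_values.
by split; rewrite ?sqrtr_ge0 // sqr_sqrtr.
Qed.

(** A real symmetric matrix is diagonalized by the spectral theorem over
    [R[i]]; its complex eigenvalues are real, and a real eigenvalue of the
    complexified matrix is already one over [R]. So the trace is a sum of [k]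
    eigenvalues of [P]. *)
Lemma symmetric_trace_le (R : realType) (k : nat) (P : 'M[R]_k) (b : R) :
  P^T = P -> (forall a, eigenvalue P a -> a <= b) -> \tr P <= k%:R * b.
Proof.
move=> Psym Pb; pose f : {rmorphism R -> R[i]} := real_complex R.
pose PC := map_mx f P.
have PCh : PC \is hermsymmx.
  apply: realsym_hermsym.
    apply/is_hermitianmxP; rewrite expr0 scale1r; apply/matrixP => i j.
    by rewrite !mxE -[in LHS]Psym mxE.
  apply/mxOverP => i j; rewrite mxE; apply/complex_realP.
  by exists (P i j).
have /orthomx_spectralP PE := hermitian_normalmx PCh.
have Dreal := hermitian_spectral_diag_real PCh.
set U := spectralmx PC in PE; set D := spectral_diag PC in PE Dreal.
have Uu : U \in unitmx by exact: spectral_unit.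
pose d i : R := complex.Re (D 0 i).
have dE i : D 0 i = f (d i).
  by rewrite /d; have /mxOverP/(_ 0 i)/complex_realP[x ->] := Dreal.
have deig i : d i <= b.
  apply: Pb; rewrite -(eigenvalue_map f); apply/eigenvalueP.
  exists (row i U); last first.
    apply/eqP => r0; move: Uu; rewrite -row_free_unit => /row_freeP [V VU].
    have := congr1 (row i) VU; rewrite row_mul r0 mul0mx => /rowP/(_ i).
    by rewrite !mxE eqxx => /esym/eqP; rewrite oner_eq0.
  rewrite -/PC {1}PE -row_mul !mulmxA mulmxV // mul1mx row_mul row_diag_mx.
  by rewrite -scalemxAl -rowE dE.
have : f (\tr P) = f (\sum_i d i).
  rewrite -[f (\tr P)](trace_map_mx f P) -/PC PE mxtrace_mulC mulmxA mulmxV //.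
  rewrite mul1mx mxtrace_diag rmorph_sum /=.
  by apply: eq_bigr => i _; rewrite dE.
move/(fmorph_inj f) => ->.
apply: (@le_trans _ _ (\sum_(i < k) b)).
  by apply: ler_sum => i _; exact: deig.
by rewrite sumr_const card_ord mulr_natl.
Qed.

(** The trace of [M^T *m M] is the sum of all squared entries of [M], and is at
    most [k] times the largest squared singular value. *)
Lemma entry_sqr_le_specnorm (R : realType) (m k : nat) (M : 'M[R]_(m, k)) i j :
  M i j ^+ 2 <= k%:R * specnorm M ^+ 2.
Proof.
apply: le_trans (_ : \tr (M^T *m M) <= _); last first.
  apply: symmetric_trace_le; first by rewrite trmx_mul trmxK.
  exact: eigenvalue_le_specnorm.
rewrite /mxtrace (bigD1 j) //= [X in X + _]mxE (bigD1 i) //= mxE -expr2.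
rewrite -addrA lerDl addr_ge0 ?sumr_ge0 // => p _;
  rewrite mxE -?expr2 ?sqr_ge0 //.
by apply: sumr_ge0 => q _; rewrite mxE -expr2 sqr_ge0.
Qed.

Lemma entry_le_specnorm (R : realType) (m k : nat) (M : 'M[R]_(m, k)) i j :
  `|M i j| <= k%:R * specnorm M.
Proof.
rewrite -(ler_pXn2r (n := 2)) // ?nnegrE ?mulr_ge0 ?specnorm_ge0 //.
rewrite real_normK ?num_real //.
apply: le_trans (entry_sqr_le_specnorm M i j) _.
rewrite exprMn ler_wpM2r ?sqr_ge0 // -natrX ler_nat.
by case: k M j => [|k] M j; rewrite // -mulnn leq_pmulr.
Qed.

(** * Symplectic matrices and quadratic forms *)

Lemma mxBE (R : realType) (m k : nat) (X Y : 'M[R]_(m, k)) i j :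
  (X - Y) i j = X i j - Y i j.
Proof. by rewrite mxE [X in _ + X]mxE. Qed.

Lemma Jmx_mull (R : realType) (n k : nat) (X : 'M[R]_(n + n, k)) j c :
  (Jmx R n *m X) (lshift n j) c = X (rshift n j) c.
Proof.
rewrite -[X in _ *m X]vsubmxK /Jmx mul_block_col !mul0mx add0r mul1mx col_mxEu.
by rewrite mxE.
Qed.

Lemma Jmx_mulr (R : realType) (n k : nat) (X : 'M[R]_(n + n, k)) j c :
  (Jmx R n *m X) (rshift n j) c = - X (lshift n j) c.
Proof.
rewrite -[X in _ *m X]vsubmxK /Jmx mul_block_col !mul0mx addr0 mulNmx mul1mx.
by rewrite col_mxEd !mxE.
Qed.

Lemma mul_Jmxl (R : realType) (n k : nat) (X : 'M[R]_(k, n + n)) c j :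
  (X *m Jmx R n) c (lshift n j) = - X c (rshift n j).
Proof.
rewrite -[X in X *m _]hsubmxK /Jmx mul_row_block !mulmx0 add0r mulmxN mulmx1.
by rewrite row_mxEl !mxE.
Qed.

Lemma mul_Jmxr (R : realType) (n k : nat) (X : 'M[R]_(k, n + n)) c j :
  (X *m Jmx R n) c (rshift n j) = X c (lshift n j).
Proof.
rewrite -[X in X *m _]hsubmxK /Jmx mul_row_block !mulmx0 addr0 mulmx1.
by rewrite row_mxEr !mxE.
Qed.

Lemma Jmx_sqr (R : realType) (n : nat) : Jmx R n *m Jmx R n = - 1%:M.
Proof.
rewrite /Jmx mulmx_block !mul0mx !mulmx0 mulmx1 mul1mx addr0 add0r !addr0.
by rewrite scalar_mx_block opp_block_mx oppr0.
Qed.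

(** The symplectic pair to which a coordinate belongs: coordinates [j] and
    [n + j] share the eigenvalue [d 0 j]. *)
Definition mode (n : nat) (p : 'I_(n + n)) : 'I_n :=
  match split p with inl j => j | inr j => j end.

Lemma mode_lshift n j : mode (lshift n j) = j :> 'I_n.
Proof. by rewrite /mode (unsplitK (inl j)). Qed.

Lemma mode_rshift n j : mode (rshift n j) = j :> 'I_n.
Proof. by rewrite /mode (unsplitK (inr j)). Qed.

Definition modeE := (mode_lshift, mode_rshift).

Lemma ord_double_ind n (P : 'I_(n + n) -> Prop) :
  (forall j, P (lshift n j)) -> (forall j, P (rshift n j)) -> forall p, P p.
Proof. by move=> Pl Pr p; rewrite -(splitK p); case: split. Qed.

Lemma diag_double_mul (R : realType) (n k : nat) (d : 'rV[R]_n)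
    (X : 'M[R]_(n + n, k)) p c :
  (diag_double d *m X) p c = d 0 (mode p) * X p c.
Proof.
rewrite -[X in LHS]vsubmxK /diag_double mul_block_col !mul0mx addr0 add0r.
by elim/ord_double_ind: p => j;
  rewrite ?col_mxEu ?col_mxEd mul_diag_mx !mxE ?modeE.
Qed.

Lemma mul_diag_double (R : realType) (n k : nat) (d : 'rV[R]_n)
    (X : 'M[R]_(k, n + n)) c p :
  (X *m diag_double d) c p = X c p * d 0 (mode p).
Proof.
rewrite -[X in LHS]hsubmxK /diag_double mul_row_block !mulmx0 addr0 add0r.
by elim/ord_double_ind: p => j;
  rewrite ?row_mxEl ?row_mxEr mul_mx_diag !mxE ?modeE.
Qed.

Lemma diag_doubleE (R : realType) (n : nat) (d : 'rV[R]_n) p q :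
  diag_double d p q = d 0 (mode p) * (p == q)%:R.
Proof. by rewrite -[diag_double d]mulmx1 diag_double_mul mxE. Qed.

Definition qform (R : realType) (m : nat) (A : 'M[R]_m) (x : 'cV[R]_m) : R :=
  (x^T *m A *m x) 0 0.

Lemma qform_mulmx (R : realType) (m : nat) (A B : 'M[R]_m) (x : 'cV[R]_m) :
  qform A (B *m x) = qform (B^T *m A *m B) x.
Proof. by rewrite /qform trmx_mul !mulmxA. Qed.

Lemma qformD (R : realType) (m : nat) (A B : 'M[R]_m) (x : 'cV[R]_m) :
  qform (A + B) x = qform A x + qform B x.
Proof. by rewrite /qform mulmxDr mulmxDl mxE. Qed.

Lemma qform_diag_double (R : realType) (n : nat) (d : 'rV[R]_n)
    (x : 'cV[R]_(n + n)) :
  qform (diag_double d) x =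
  \sum_j d 0 j * (x (lshift n j) 0 ^+ 2 + x (rshift n j) 0 ^+ 2).
Proof.
rewrite /qform mxE big_split_ord /= -big_split /=; apply: eq_bigr => j _.
by rewrite !mul_diag_double !modeE !mxE; ring.
Qed.

Lemma sum_sqr_double (R : realType) (n : nat) (x : 'cV[R]_(n + n)) :
  \sum_p x p 0 ^+ 2 =
  \sum_j (x (lshift n j) 0 ^+ 2 + x (rshift n j) 0 ^+ 2).
Proof. by rewrite big_split_ord /= -big_split. Qed.

Lemma qform_le (R : realType) (m : nat) (E : 'M[R]_m) (v : 'cV[R]_m) :
  `|qform E v| <= (\sum_p \sum_q `|E p q|) * \sum_p v p 0 ^+ 2.
Proof.
rewrite /qform mxE.
under eq_bigr => q _ do rewrite mxE mulr_suml.
rewrite exchange_big /= mulr_suml; apply: le_trans (ler_norm_sum _ _ _) _.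
apply: ler_sum => p _; apply: le_trans (ler_norm_sum _ _ _) _.
rewrite mulr_suml; apply: ler_sum => q _.
rewrite mxE mulrAC mulrC normrM ler_wpM2l //.
exact: (sqr_sum_abs_le (fun p => v p 0)).
Qed.

(** The inverse of a symplectic matrix is [- J M^T J]. *)
Lemma Sp_mulJ (R : realType) (n : nat) (M : 'M[R]_(n + n)) :
  Sp M -> - (Jmx R n *m M^T *m Jmx R n) *m M = 1%:M.
Proof.
rewrite /Sp /= => HM; rewrite mulNmx.
have -> : Jmx R n *m M^T *m Jmx R n *m M = Jmx R n *m (M^T *m Jmx R n *m M).
  by rewrite !mulmxA.
by rewrite HM Jmx_sqr opprK.
Qed.

Lemma Sp_unit (R : realType) (n : nat) (M : 'M[R]_(n + n)) :
  Sp M -> M \in unitmx.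
Proof. by move/Sp_mulJ/mulmx1_unit => []. Qed.

Lemma Sp_inv (R : realType) (n : nat) (M : 'M[R]_(n + n)) :
  Sp M -> Sp (invmx M).
Proof.
move=> HM; have uM := Sp_unit HM; rewrite /Sp /= -{1}HM.
by rewrite trmx_inv !mulmxA mulVmx ?unitmx_tr // mul1mx mulmxK.
Qed.

Lemma Sp_mul (R : realType) (n : nat) (M N : 'M[R]_(n + n)) :
  Sp M -> Sp N -> Sp (M *m N).
Proof.
rewrite /Sp /= => HM HN.
by rewrite trmx_mul !mulmxA -[N^T *m _ *m _]mulmxA -[N^T *m _ *m _]mulmxA HM.
Qed.

(** The one-sided inverse of [Sp_mulJ] is two-sided, so the transpose of a
    symplectic matrix is symplectic too. *)
Lemma Sp_trmx (R : realType) (n : nat) (M : 'M[R]_(n + n)) :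
  Sp M -> M *m Jmx R n *m M^T = Jmx R n.
Proof.
move=> /Sp_mulJ/mulmx1C; rewrite mulmxN !mulmxA => MJ.
have /(congr1 (fun X => X *m Jmx R n)) := MJ.
rewrite mulNmx -[_ *m Jmx R n *m Jmx R n]mulmxA Jmx_sqr.
by rewrite mulmxN mulmx1 opprK mul1mx.
Qed.

(** * Perturbation of symplectic eigenvalues *)

Lemma zero_row_kernel (R : realType) (m : nat) (G : 'M[R]_m) (i : 'I_m) :
  row i G = 0 -> exists2 u : 'cV_m, u != 0 & G *m u = 0.
Proof.
move=> Gi; have : \det G^T == 0.
  rewrite det_tr (expand_det_row _ i) big1 // => j _.
  by have /rowP/(_ j) := Gi; rewrite !mxE => ->; rewrite mul0r.
case/det0P => v v0 vG; exists v^T; first by rewrite trmx_eq0.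
by rewrite -[G]trmxK -trmx_mul vG trmx0.
Qed.

Lemma sum_sqr_cV_gt0 (R : realType) (m : nat) (u : 'cV[R]_m) :
  u != 0 -> 0 < \sum_i u i 0 ^+ 2.
Proof.
move=> u0; have [|i] := @row_neq0_entry _ _ u^T; first by rewrite trmx_eq0.
rewrite mxE => ui; exact: (sum_sqr_gt0 (i := i)).
Qed.

(** Monotonicity of symplectic eigenvalues, proved as in Courant-Fischer by
    intersecting two subspaces. For a vector [u] put [x = M u] and
    [y = - M J u]; since [M] is symplectic, [x^T J y] is the squared norm [N] of
    [u]. If [u] is supported on the modes up to [k], the forms of
    [diag_double d'] at [u] and [J u] add up to at most [2 d'_k N]. If moreover
    [y = J x] on the modes below [k], those modes contribute at most 0 to
    [x^T J y], and the remaining ones show that the forms of [diag_double d] at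
    [x] and [y] add up to at least [2 d_k N]. The two requirements are
    [2n - 2] linear equations for the [2n] coordinates of [u], so a nonzero
    [u] exists. *)
Lemma symplectic_form_le_eig (R : realType) (n : nat) (M : 'M[R]_(n + n))
    (d d' : 'rV[R]_n) (c : R) (k : 'I_n) :
  Sp M -> (forall j, 0 < d 0 j) ->
  (forall i j : 'I_n, (i <= j)%N -> d 0 i <= d 0 j) ->
  (forall i j : 'I_n, (i <= j)%N -> d' 0 i <= d' 0 j) ->
  0 <= c ->
  (forall u, c * qform (diag_double d) (M *m u) <= qform (diag_double d') u) ->
  c * d 0 k <= d' 0 k.
Proof.
rewrite /Sp /= => HM d_gt0 d_incr d'_incr c0 le_q.
set J := Jmx R n in HM.
(* Both requirements on u, as one square system whose rows at mode k vanish. *)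
pose G : 'M[R]_(n + n) := \matrix_(p, q)
  if (mode p < k)%N then (J *m M + M *m J) p q
  else if (k < mode p)%N then (p == q)%:R else 0.
have [u u0 Gu] : exists2 u : 'cV_(n + n), u != 0 & G *m u = 0.
  apply: (@zero_row_kernel _ _ _ (lshift n k)).
  by apply/rowP => q; rewrite !mxE modeE ltnn.
have usupp p : (k < mode p)%N -> u p 0 = 0.
  move=> kp; have /matrixP/(_ p 0) := Gu; rewrite !mxE (bigD1 p) //= big1.
    by rewrite !mxE kp ltnNge ltnW //= eqxx mul1r addr0.
  by move=> q qp; rewrite !mxE kp ltnNge ltnW //= eq_sym (negPf qp) mul0r.
pose x := M *m u; pose y := - (M *m (J *m u)).
have xy p : (mode p < k)%N -> y p 0 = (J *m x) p 0.
  move=> pk; apply/eqP; rewrite eq_sym -subr_eq0; apply/eqP.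
  have -> : (J *m x) p 0 - y p 0 = ((J *m M + M *m J) *m u) p 0.
    by rewrite /x /y [X in _ - X]mxE opprK mulmxDl !mulmxA [RHS]mxE.
  have /matrixP/(_ p 0) := Gu; rewrite [in X in _ = X -> _]mxE => <-.
  by rewrite !mxE; apply: eq_bigr => q _; rewrite [in RHS]mxE pk.
have xJy : (x^T *m J *m y) 0 0 = \sum_p u p 0 ^+ 2.
  have -> : x^T *m J *m y = u^T *m u.
    have -> : x^T *m J *m y = - (u^T *m (M^T *m J *m M) *m J *m u).
      by rewrite /x /y trmx_mul mulmxN !mulmxA.
    rewrite HM.
    by rewrite -[u^T *m J *m J]mulmxA Jmx_sqr mulmxN mulmx1 mulNmx opprK.
  by rewrite mxE; apply: eq_bigr => p _; rewrite mxE expr2.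
have Nu := sum_sqr_cV_gt0 u0; set N := \sum_i _ in Nu xJy.
have le1 : 2 * d 0 k * N <= qform (diag_double d) x + qform (diag_double d) y.
  rewrite -xJy -mulmxA mxE big_split_ord /= -big_split /= mulr_sumr.
  rewrite !qform_diag_double -big_split /=; apply: ler_sum => j _.
  rewrite Jmx_mull Jmx_mulr ![x^T _ _]mxE.
  have dk := d_gt0 k; have dj := d_gt0 j.
  have [jk|kj] := ltnP j k.
    have := xy (lshift n j); have := xy (rshift n j).
    rewrite !modeE Jmx_mull Jmx_mulr => -> // -> //.
    nra.
  have := d_incr _ _ kj.
  move: (x _ 0) (x _ 0) (y _ 0) (y _ 0) => b a e f dkj.
  have h : 2 * (a * f - b * e) <= a ^+ 2 + b ^+ 2 + (e ^+ 2 + f ^+ 2).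
    by have := sqr_ge0 (a - f); have := sqr_ge0 (b + e); lra.
  have h0 : 0 <= a ^+ 2 + b ^+ 2 + (e ^+ 2 + f ^+ 2).
    by rewrite !addr_ge0 ?sqr_ge0.
  have := ler_wpM2l (ltW dk) h; have := ler_wpM2r h0 dkj.
  lra.
have le2 (v : 'cV[R]_(n + n)) : (forall p, (k < mode p)%N -> v p 0 = 0) ->
    qform (diag_double d') v <= d' 0 k * \sum_p v p 0 ^+ 2.
  move=> v0; rewrite qform_diag_double sum_sqr_double mulr_sumr.
  apply: ler_sum => j _; have [jk|kj] := leqP j k.
    by rewrite ler_wpM2r ?addr_ge0 ?sqr_ge0 ?d'_incr.
  by rewrite !v0 ?modeE // expr0n /= addr0 !mulr0.
have le_u := le2 u usupp; rewrite -/N in le_u.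
have le_Ju : qform (diag_double d') (- (J *m u)) <= d' 0 k * N.
  have -> : N = \sum_p (- (J *m u)) p 0 ^+ 2.
    rewrite /N !sum_sqr_double; apply: eq_bigr => j _.
    by rewrite ![(- _ : 'cV__) _ _]mxE Jmx_mull Jmx_mulr opprK sqrrN addrC.
  apply: le2; elim/ord_double_ind => j; rewrite modeE => kj.
    by rewrite mxE Jmx_mull usupp ?modeE ?oppr0.
  by rewrite mxE Jmx_mulr usupp ?modeE ?oppr0.
have := le_q u; have := le_q (- (J *m u)); rewrite mulmxN -/x -/y => lb_y lb_x.
rewrite -(ler_pM2r Nu); have := ler_wpM2l c0 le1.
lra.
Qed.

(** The form of [diag_double d + E] lies between [1 - e] and [1 + e] times that
    of [diag_double d]. Monotonicity along [M] gives the lower bound on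
    [d'], and monotonicity along the inverse of [M] the upper one. *)
Lemma symplectic_eig_pert (R : realType) (n : nat) (M E : 'M[R]_(n + n))
    (d d' : 'rV[R]_n) (e : R) (k : 'I_n) :
  Sp M -> (forall j, 0 < d 0 j) ->
  (forall i j : 'I_n, (i <= j)%N -> d 0 i <= d 0 j) ->
  (forall i j : 'I_n, (i <= j)%N -> d' 0 i <= d' 0 j) ->
  M^T *m (diag_double d + E) *m M = diag_double d' ->
  0 <= e -> e < 1 ->
  (forall v, `|qform E v| <= e * qform (diag_double d) v) ->
  `|d' 0 k - d 0 k| <= e * d 0 k.
Proof.
move=> HM d_gt0 d_incr d'_incr HE e0 e1 qE.
have uM := Sp_unit HM.
have lb j : (1 - e) * d 0 j <= d' 0 j.
  apply: (@symplectic_form_le_eig _ _ M) => // [|u].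
    by rewrite subr_ge0 ltW.
  rewrite -HE -qform_mulmx qformD mulrBl mul1r lerD2l.
  by have := qE (M *m u); rewrite ler_norml => /andP[].
have d'_gt0 j : 0 < d' 0 j.
  by apply: lt_le_trans (lb j); rewrite mulr_gt0 // subr_gt0.
have ub : (1 + e)^-1 * d' 0 k <= d 0 k.
  have e_gt0 : 0 < 1 + e by rewrite ltr_wpDr.
  apply: (@symplectic_form_le_eig _ _ (invmx M)) => // [||u].
  - exact: Sp_inv.
  - by rewrite invr_ge0 ltW.
  rewrite -HE -qform_mulmx mulKVmx // ler_pdivrMl // qformD mulrDl mul1r lerD2l.
  by have := qE u; rewrite ler_norml => /andP[].
have := lb k; move: ub; rewrite ler_pdivrMl ?ltr_wpDr // => ub lbk.
by rewrite ler_distl; lra.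
Qed.

(** The zero row, default value in the definition of [symp_eigs], is
    nondecreasing as well. *)
Lemma symp_eigs_incr (R : realType) (n : nat) (A : 'M[R]_(n + n))
    (i j : 'I_n) :
  (i <= j)%N -> symp_eigs A 0 i <= symp_eigs A 0 j.
Proof.
rewrite /symp_eigs; case: xgetP => [d _ [_ d_incr _]|_] ij; first exact: d_incr.
by rewrite !mxE.
Qed.

(** The [j]-th symplectic eigenvalue is the value of the form of [A] at the
    [j]-th column of [S]. *)
Lemma symp_eigs_gt0 (R : realType) (n : nat) (A S : 'M[R]_(n + n)) (j : 'I_n) :
  Pd A -> SpA A S -> 0 < symp_eigs A 0 j.
Proof.
rewrite /Pd /SpA /= => -[_ Apos] [HS SAS].
pose x := col (lshift n j) S.
have -> : symp_eigs A 0 j = (x^T *m A *m x) 0 0.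
  rewrite -/(qform A x) /x colE qform_mulmx SAS.
  rewrite qform_diag_double (bigD1 j) //= big1 ?addr0 => [|i ij].
    by rewrite !mxE eqxx eq_rlshift expr1n expr0n addr0 mulr1.
  by rewrite !mxE eq_lshift (negPf ij) eq_rlshift expr0n /= addr0 mulr0.
apply: Apos; apply/eqP; rewrite /x colE => x0.
have /matrixP/(_ (lshift n j) 0) :
    delta_mx (lshift n j) 0 = 0 :> 'cV[R]_(n + n).
  by rewrite -[LHS](mulKmx (Sp_unit HS)) x0 mulmx0.
by rewrite !mxE !eqxx => /eqP; rewrite oner_eq0.
Qed.

(** * Order of magnitude of families *)

Definition eventually (R : realType) (T : Type) (D : T -> Prop) (h : T -> R)
    (P : T -> Prop) : Prop :=
  exists2 delta, 0 < delta & forall t, D t -> h t < delta -> P t.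

(** Here [D] selects the admissible parameters [t] and [h t] is their size:
    [f t = O(h t ^ p)] as [h t] tends to 0, uniformly over all admissible [t] of
    a given size. *)
Definition isO (R : realType) (T : Type) (D : T -> Prop) (h : T -> R)
    (p : nat) (f : T -> R) : Prop :=
  exists2 c, 0 < c & eventually D h (fun t => `|f t| <= c * h t ^+ p).

Definition isOmx (R : realType) (T : Type) (D : T -> Prop) (h : T -> R)
    (p m k : nat) (F : T -> 'M[R]_(m, k)) : Prop :=
  forall i j, isO D h p (fun t => F t i j).

Section BigO.
Variables (R : realType) (T : Type) (D : T -> Prop) (h : T -> R).
Hypothesis h_ge0 : forall t, 0 <= h t.

Lemma eventuallyW (P : T -> Prop) :
  (forall t, D t -> P t) -> eventually D h P.
Proof. by move=> PD; exists 1 => // t Dt _; exact: PD. Qed.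

Lemma eventually2 (P Q W : T -> Prop) :
  (forall t, D t -> P t -> Q t -> W t) ->
  eventually D h P -> eventually D h Q -> eventually D h W.
Proof.
move=> PQW [a a0 aP] [b b0 bQ]; exists (Num.min a b).
  by rewrite lt_min a0 b0.
move=> t Dt; rewrite lt_min => /andP[ta tb].
by apply: PQW => //; [exact: aP | exact: bQ].
Qed.

Lemma isO_le (p : nat) (f g : T -> R) :
  isO D h p g -> eventually D h (fun t => `|f t| <= `|g t|) -> isO D h p f.
Proof.
move=> [c c0 cg] fg; exists c => //.
by apply: eventually2 fg cg => t _; exact: le_trans.
Qed.

Lemma isO_ext (p : nat) (f g : T -> R) :
  isO D h p g -> (forall t, D t -> f t = g t) -> isO D h p f.
Proof. by move=> Og fg; apply: (isO_le Og); apply: eventuallyW => t /fg ->. Qed.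

Lemma isO_cst (a : R) : isO D h 0 (fun=> a).
Proof.
exists (`|a| + 1); first by rewrite ltr_wpDl.
by apply: eventuallyW => t _; rewrite expr0 mulr1 lerDl.
Qed.

Lemma isO0 (p : nat) : isO D h p (fun=> 0).
Proof.
exists 1 => //; apply: eventuallyW => t _.
by rewrite normr0 mul1r exprn_ge0.
Qed.

Lemma isO_size : isO D h 1 h.
Proof.
by exists 1 => //; apply: eventuallyW => t _; rewrite mul1r expr1 ger0_norm.
Qed.

Lemma isON (p : nat) (f : T -> R) :
  isO D h p f -> isO D h p (fun t => - f t).
Proof.
by move=> Of; apply: (isO_le Of); apply: eventuallyW => t _; rewrite normrN.
Qed.

Lemma isOD (p : nat) (f g : T -> R) :
  isO D h p f -> isO D h p g -> isO D h p (fun t => f t + g t).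
Proof.
move=> [c c0 fc] [e e0 ge]; exists (c + e); first exact: addr_gt0.
apply: eventually2 fc ge => t _ lf lg; apply: le_trans (ler_normD _ _) _.
by rewrite mulrDl lerD.
Qed.

Lemma isOB (p : nat) (f g : T -> R) :
  isO D h p f -> isO D h p g -> isO D h p (fun t => f t - g t).
Proof. by move=> Of Og; apply: isOD Of (isON Og). Qed.

Lemma isOM (p q : nat) (f g : T -> R) :
  isO D h p f -> isO D h q g -> isO D h (p + q) (fun t => f t * g t).
Proof.
move=> [c c0 fc] [e e0 ge]; exists (c * e); first exact: mulr_gt0.
apply: eventually2 fc ge => t _ lf lg.
by rewrite normrM exprD mulrACA ler_pM.
Qed.

Lemma isO_sum (p : nat) (I : finType) (P : pred I) (f : I -> T -> R) :
  (forall i, P i -> isO D h p (f i)) ->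
  isO D h p (fun t => \sum_(i | P i) f i t).
Proof.
move=> Of; elim: (index_enum I) => [|i s IH].
  by apply: isO_ext (isO0 p) _ => t _; rewrite big_nil.
case Pi : (P i).
  by apply: isO_ext (isOD (Of i Pi) IH) _ => t _; rewrite big_cons Pi.
by apply: isO_ext IH _ => t _; rewrite big_cons Pi.
Qed.

Lemma isO_weaken (p : nat) (f : T -> R) : isO D h p.+1 f -> isO D h p f.
Proof.
move=> [c c0 fc]; exists c => //.
have h1 : eventually D h (fun t => h t < 1) by exists 1.
apply: eventually2 fc h1 => t _ /le_trans le_f ht; apply: le_f.
rewrite ler_pM2l // exprSr -[leRHS]mulr1 ler_wpM2l ?exprn_ge0 //.
exact: ltW.
Qed.

Lemma isO_eventually_le (f : T -> R) (a : R) :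
  isO D h 1 f -> 0 < a -> eventually D h (fun t => `|f t| <= a).
Proof.
move=> [c c0 fc] a0.
have ha : eventually D h (fun t => h t < a / c).
  by exists (a / c); rewrite ?divr_gt0.
apply: eventually2 fc ha => t _ /le_trans le_f ht; apply: le_f.
by rewrite expr1 mulrC -ler_pdivlMr // ltW.
Qed.

Lemma isOmxD (p m k : nat) (F G : T -> 'M[R]_(m, k)) :
  isOmx D h p F -> isOmx D h p G -> isOmx D h p (fun t => F t + G t).
Proof.
move=> OF OG i j; apply: (isO_ext (isOD (OF i j) (OG i j))) => t _.
by rewrite mxE.
Qed.

Lemma isOmxB (p m k : nat) (F G : T -> 'M[R]_(m, k)) :
  isOmx D h p F -> isOmx D h p G -> isOmx D h p (fun t => F t - G t).
Proof.
move=> OF OG i j; apply: (isO_ext (isOB (OF i j) (OG i j))) => t _.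
by rewrite !mxE.
Qed.

Lemma isOmx_mul (p q m k l : nat) (F : T -> 'M[R]_(m, k))
    (G : T -> 'M[R]_(k, l)) :
  isOmx D h p F -> isOmx D h q G -> isOmx D h (p + q) (fun t => F t *m G t).
Proof.
move=> OF OG i j; have Os : isO D h (p + q) (fun t => \sum_a F t i a * G t a j).
  by apply: isO_sum => a _; exact: isOM (OF i a) (OG a j).
by apply: (isO_ext Os) => t _; rewrite mxE.
Qed.

Lemma isOmx_cst (m k : nat) (B : 'M[R]_(m, k)) : isOmx D h 0 (fun=> B).
Proof. by move=> i j; exact: isO_cst. Qed.

Lemma isOmx_tr (p m k : nat) (F : T -> 'M[R]_(m, k)) :
  isOmx D h p F -> isOmx D h p (fun t => (F t)^T).
Proof. by move=> OF i j; apply: (isO_ext (OF j i)) => t _; rewrite mxE. Qed.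

Lemma isOmx_ext (p m k : nat) (F G : T -> 'M[R]_(m, k)) :
  isOmx D h p G -> (forall t, D t -> F t = G t) -> isOmx D h p F.
Proof. by move=> OG FG i j; apply: (isO_ext (OG i j)) => t /FG ->. Qed.

Lemma isOmx_specnorm (p m k : nat) (F : T -> 'M[R]_(m, k)) :
  isOmx D h p F -> isO D h p (fun t => specnorm (F t)).
Proof.
move=> OF; pose N t := \sum_i \sum_j `|F t i j|.
have ON : isO D h p N.
  apply: isO_sum => i _; apply: isO_sum => j _; apply: (isO_le (OF i j)).
  by apply: eventuallyW => t _; rewrite normr_id.
have N0 t : 0 <= N t by apply: sumr_ge0 => i _; apply: sumr_ge0.
apply: (isO_le (isOM (isO_cst (m * k ^ 2).+1%:R) ON)).
apply: eventuallyW => t _; rewrite !ger0_norm ?specnorm_ge0 ?mulr_ge0 //.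
apply: specnorm_le => // i j; rewrite /N (bigD1 i) //= (bigD1 j) //= -addrA.
by rewrite lerDl addr_ge0 ?sumr_ge0 // => q _; rewrite sumr_ge0.
Qed.

End BigO.

(** * Entries of the transition matrix *)

(** An explicit bound avoids singling out the empty index type. *)
Lemma pos_lower_bound (R : realType) (I : finType) (f : I -> R) :
  (forall i, 0 < f i) -> exists2 m, 0 < m & forall i, m <= f i.
Proof.
move=> f0; have fV0 i : 0 <= (f i)^-1 by rewrite invr_ge0 ltW.
have s0 : 0 < 1 + \sum_i (f i)^-1 by rewrite ltr_pwDl // sumr_ge0.
exists (1 + \sum_i (f i)^-1)^-1 => [|i]; first by rewrite invr_gt0.
rewrite -[leRHS]invrK lef_pV2 ?posrE ?invr_gt0 //.
by rewrite (bigD1 i) //= addrCA lerDl addr_ge0 // sumr_ge0.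
Qed.

(** Pairs [(H, S')] of a perturbation of [A] and a matrix that, when the pair is
    admissible, brings [A + H] to its Williamson normal form. *)
Definition perturbation (R : realType) (n : nat) : Type :=
  ('M[R]_(n + n) * 'M[R]_(n + n))%type.

Definition admissible (R : realType) (n : nat) (A : 'M[R]_(n + n))
    (t : perturbation R n) : Prop :=
  [/\ Sm t.1, Pd (A + t.1) & SpA (A + t.1) t.2].

Definition pert_size (R : realType) (n : nat) (t : perturbation R n) : R :=
  specnorm t.1.

Section Perturbation.
Variables (R : realType) (n : nat) (A S : 'M[R]_(n + n)).
Hypotheses (A_pd : Pd A) (S_A : SpA A S).

Local Notation D := (admissible A).
Local Notation h := (@pert_size R n).
Let J := Jmx R n.
Let d := symp_eigs A.
Let L := diag_double d.
Let d' (t : perturbation R n) := symp_eigs (A + t.1).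
Let M (t : perturbation R n) := invmx S *m t.2.
Let E (t : perturbation R n) := S^T *m t.1 *m S.

Let h_ge0 t : 0 <= h t. Proof. exact: specnorm_ge0. Qed.
Let d_gt0 j : 0 < d 0 j. Proof. exact: symp_eigs_gt0 A_pd S_A. Qed.
Let S_unit : S \in unitmx. Proof. by case: S_A => /Sp_unit. Qed.

Let M_Sp t : D t -> Sp (M t).
Proof.
by case=> _ _ [S'_Sp _]; apply: Sp_mul => //; apply: Sp_inv; case: S_A.
Qed.

(** The matrix [M t] brings the perturbed normal form [L + E t] of [A] to the
    normal form of [A + H]. *)
Let M_congr t : D t -> (M t)^T *m (L + E t) *m M t = diag_double (d' t).
Proof.
case=> _ _ [_ <-]; case: S_A => _ SAS; rewrite /L /d -SAS /E -mulmxDl -mulmxDr.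
have S'E : t.2 = S *m M t by rewrite /M mulKVmx.
by rewrite [in RHS]S'E [in RHS]trmx_mul !mulmxA.
Qed.

Lemma isO_entry_H : isOmx D h 1 (fun t => t.1).
Proof.
move=> i j.
have Oh : isO D h 1 (fun t => (n + n)%:R * h t).
  exact: (isOM (isO_cst D h _) (isO_size D h_ge0)).
apply: (isO_le Oh); apply: eventuallyW => t _.
apply: le_trans (entry_le_specnorm _ i j) _.
exact: ler_norm.
Qed.

Lemma isO_congr_H : isOmx D h 1 E.
Proof.
exact: (isOmx_mul h_ge0 (p := 1) (q := 0)
         (isOmx_mul h_ge0 (p := 0) (q := 1) (isOmx_cst D h _) isO_entry_H)
         (isOmx_cst D h _)).
Qed.

Let e (t : perturbation R n) : R := \sum_p \sum_q `|E t p q|.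

Lemma isO_congr_H_sum : isO D h 1 e.
Proof.
apply: isO_sum => // p _; apply: isO_sum => // q _.
apply: (isO_le (isO_congr_H p q)).
by apply: eventuallyW => t _; rewrite normr_id.
Qed.

Let e_ge0 t : 0 <= e t.
Proof. by apply: sumr_ge0 => p _; apply: sumr_ge0. Qed.

(** Here [m] is a positive lower bound of the symplectic eigenvalues of [A]. *)
Lemma qform_E_le : exists2 m : R, 0 < m &
  (forall v : 'cV[R]_(n + n), \sum_p v p 0 ^+ 2 <= m^-1 * qform L v) /\
  forall t (v : 'cV[R]_(n + n)), `|qform (E t) v| <= e t / m * qform L v.
Proof.
have [m m0 md] := pos_lower_bound d_gt0.
have Lm (v : 'cV[R]_(n + n)) : \sum_p v p 0 ^+ 2 <= m^-1 * qform L v.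
  rewrite ler_pdivlMl // qform_diag_double sum_sqr_double mulr_sumr.
  by apply: ler_sum => j _; rewrite ler_wpM2r ?addr_ge0 ?sqr_ge0.
exists m => //; split=> // t v; apply: le_trans (qform_le _ _) _.
by rewrite -[leRHS]mulrA; apply: ler_wpM2l (e_ge0 t) _ _ (Lm v).
Qed.

(** Symplectic eigenvalues are Lipschitz at [A]: for small [H], the form of
    [E t] is at most half that of [L]. *)
Lemma isO_eig k : isO D h 1 (fun t => d' t 0 k - d 0 k).
Proof.
have [m m0 [_ Em]] := qform_E_le.
have Oe : isO D h 1 (fun t => e t / m * d 0 k).
  apply: (isO_ext (isOM isO_congr_H_sum (isO_cst D h (d 0 k / m)))) => t _.
  by rewrite mulrA mulrAC.
apply: (isO_le Oe).
have m2 : 0 < m / 2 by rewrite divr_gt0.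
have [a a0 ea] := isO_eventually_le isO_congr_H_sum m2.
exists a => // t Dt ta; apply: le_trans (ler_norm _).
apply: (@symplectic_eig_pert _ _ (M t) (E t)) => //.
- exact: M_Sp.
- by move=> i j; exact: symp_eigs_incr.
- by move=> i j; exact: symp_eigs_incr.
- exact: M_congr.
- by rewrite divr_ge0 // ltW.
- rewrite ltr_pdivrMr // mul1r; have := ea t Dt ta; rewrite ger0_norm // => et.
  by apply: le_lt_trans et _; lra.
Qed.

Lemma isO_eig0 k : isO D h 0 (fun t => d' t 0 k).
Proof.
apply: (isO_ext (isOD (isO_weaken h_ge0 (isO_eig k)) (isO_cst D h (d 0 k)))).
by move=> t _; rewrite subrK.
Qed.

(** The form of [L + E t] at column [q] of [M t] is the eigenvalue of [A + H] at
    the mode of [q], which is bounded. This form is at least half that of [L],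
    hence controls the norm of the column. *)
Lemma transition_bounded : isOmx D h 0 M.
Proof.
move=> p q; have [m m0 [Lm Em]] := qform_E_le.
have Od : isO D h 0 (fun t => 1 + 2 / m * d' t 0 (mode q)).
  apply: (isOD (isO_cst D h 1)).
  exact: (isOM (isO_cst D h (2 / m)) (isO_eig0 _)).
apply: (isO_le Od).
have m2 : 0 < m / 2 by rewrite divr_gt0.
have [a a0 ea] := isO_eventually_le isO_congr_H_sum m2.
exists a => // t Dt ta; apply: le_trans (ler_norm _).
have et := ea t Dt ta; rewrite ger0_norm // in et.
pose v := col q (M t).
have vE : v = M t *m delta_mx q 0 by rewrite -colE.
have d'E : d' t 0 (mode q) = qform L v + qform (E t) v.
  rewrite -qformD vE qform_mulmx M_congr // /qform -mulmxA mxE (bigD1 q) //=.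
  rewrite big1 ?addr0 => [|i iq].
    by rewrite diag_double_mul !mxE eqxx mulr1 mul1r.
  by rewrite !mxE (negPf iq) mul0r.
have vp : v p 0 ^+ 2 <= \sum_i v i 0 ^+ 2.
  by rewrite (bigD1 p) //= lerDl sumr_ge0 // => i _; exact: sqr_ge0.
have Lv := Lm v; have := Em t v; rewrite ler_norml => /andP[Ev _].
have Lv0 : 0 <= qform L v.
  rewrite -(pmulr_rge0 _ (_ : 0 < m^-1)) ?invr_gt0 // (le_trans _ Lv) //.
  by rewrite (le_trans _ vp) // sqr_ge0.
have em : e t / m <= 2^-1 by rewrite ler_pdivrMr // mulrC.
have Ev2 : - (2^-1 * qform L v) <= qform (E t) v.
  by apply: le_trans Ev; rewrite lerN2 ler_wpM2r.
have le1 : m^-1 * qform L v <= 2 / m * d' t 0 (mode q).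
  rewrite [2 / m]mulrC -mulrA ler_pM2l ?invr_gt0 // d'E; lra.
have : v p 0 ^+ 2 <= 2 / m * d' t 0 (mode q).
  exact: le_trans vp (le_trans Lv le1).
(* A nonnegative number is at most 1 plus its square. *)
rewrite /v mxE -(real_normK (num_real (M t p q))) => sq.
have := sqr_ge0 (`|M t p q| - 1); have := normr_ge0 (M t p q).
nra.
Qed.

(** The relation [J (L + E) M = M J L'] makes the commutator of [J L] and [M]
    equal to [M J (L' - L) - J E M]. *)
Lemma isO_commutator : isOmx D h 1 (fun t => J *m L *m M t - M t *m J *m L).
Proof.
pose F t := M t *m J *m (diag_double (d' t) - L) - J *m E t *m M t.
have OLd : isOmx D h 1 (fun t => diag_double (d' t) - L).
  move=> p q; have : isO D h 1
      (fun t => (d' t 0 (mode p) - d 0 (mode p)) * (p == q)%:R).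
    exact: isOM (isO_eig _) (isO_cst D h _).
  move/isO_ext; apply=> t _; rewrite mxBE.
  by rewrite !diag_doubleE mulrBl.
have OF : isOmx D h 1 F.
  apply: isOmxB.
    exact: (isOmx_mul h_ge0 (p := 0) (q := 1)
             (isOmx_mul h_ge0 (p := 0) (q := 0)
               transition_bounded (isOmx_cst D h _)) OLd).
  exact: (isOmx_mul h_ge0 (p := 1) (q := 0)
           (isOmx_mul h_ge0 (p := 0) (q := 1) (isOmx_cst D h _) isO_congr_H)
           transition_bounded).
apply: (isOmx_ext OF) => t Dt; rewrite /F -M_congr // mulmxBr.
have -> : M t *m J *m ((M t)^T *m (L + E t) *m M t) =
    (M t *m J *m (M t)^T) *m (L + E t) *m M t by rewrite !mulmxA.
rewrite (Sp_trmx (M_Sp Dt)) -/J mulmxDr mulmxDl.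
by rewrite addrAC addrK.
Qed.

(** The square of [J L] is minus the diagonal matrix of the squared
    eigenvalues; likewise on the right in [mul_JLJL]. *)
Lemma JLJL (X : 'M[R]_(n + n)) p q :
  (J *m (L *m (J *m (L *m X)))) p q = - (d 0 (mode p) ^+ 2 * X p q).
Proof.
elim/ord_double_ind: p => j; rewrite ?Jmx_mull ?Jmx_mulr diag_double_mul;
  by rewrite ?Jmx_mull ?Jmx_mulr diag_double_mul !modeE; ring.
Qed.

Lemma mul_JLJL (X : 'M[R]_(n + n)) p q :
  (X *m J *m L *m J *m L) p q = - (d 0 (mode q) ^+ 2 * X p q).
Proof.
elim/ord_double_ind: q => j; rewrite mul_diag_double ?mul_Jmxl ?mul_Jmxr;
  by rewrite mul_diag_double ?mul_Jmxl ?mul_Jmxr !modeE; ring.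
Qed.

(** The commutator of [M] with the diagonal matrix [(J L)^2] multiplies entry
    [(p, q)] by a difference of squared eigenvalues, nonzero here because the
    eigenvalues are positive. This commutator is [K C + C K] for [K = J L] and
    [C] the commutator of [K] and [M]. *)
Lemma isO_offdiag p q :
  d 0 (mode p) != d 0 (mode q) -> isO D h 1 (fun t => M t p q).
Proof.
move=> dpq; pose C t := J *m L *m M t - M t *m J *m L.
pose F t := J *m L *m C t + C t *m J *m L.
have OF : isOmx D h 1 F.
  apply: isOmxD.
    exact: (isOmx_mul h_ge0 (p := 0) (q := 1) (isOmx_cst D h _) isO_commutator).
  exact: (isOmx_mul h_ge0 (p := 1) (q := 0)
           (isOmx_mul h_ge0 (p := 1) (q := 0) isO_commutator (isOmx_cst D h _))
           (isOmx_cst D h _)).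
pose g := d 0 (mode q) ^+ 2 - d 0 (mode p) ^+ 2.
have g0 : g != 0.
  by rewrite subr_eq0 eqrXn2 ?ltW // eq_sym.
apply: (isO_ext (isOM (isO_cst D h g^-1) (OF p q))) => t _.
have -> : F t = J *m (L *m (J *m (L *m M t))) - M t *m J *m L *m J *m L.
  rewrite /F /C mulmxBr !mulmxBl !mulmxA -[LHS]addrA; congr (_ + _).
  by rewrite addrA addNr add0r.
rewrite mxBE JLJL mul_JLJL.
by rewrite opprK addrC -mulrBl mulKf.
Qed.

Lemma isO_offdiag_mulJ p q :
  d 0 (mode p) != d 0 (mode q) ->
  isO D h 1 (fun t => (J *m M t) p q) /\ isO D h 1 (fun t => (M t *m J) p q).
Proof.
move=> dpq; split.
  move: dpq; elim/ord_double_ind: p => j; rewrite modeE => dpq.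
    have := @isO_offdiag (rshift n j) q; rewrite modeE => /(_ dpq) O1.
    by apply: (isO_ext O1) => t _; rewrite Jmx_mull.
  have := @isO_offdiag (lshift n j) q; rewrite modeE => /(_ dpq) O1.
  by apply: (isO_ext (isON O1)) => t _; rewrite Jmx_mulr.
move: dpq; elim/ord_double_ind: q => j; rewrite modeE => dpq.
  have := @isO_offdiag p (rshift n j); rewrite modeE => /(_ dpq) O1.
  by apply: (isO_ext (isON O1)) => t _; rewrite mul_Jmxl.
have := @isO_offdiag p (lshift n j); rewrite modeE => /(_ dpq) O1.
by apply: (isO_ext O1) => t _; rewrite mul_Jmxr.
Qed.

(** When [p] and [q] carry the same eigenvalue, [J L] acts there as a nonzero
    multiple of [J] and the commutator with [J L] applies. Otherwise both terms
    are, up to sign, entries of [M] joining different eigenvalues. *)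
Lemma isO_commJ : isOmx D h 1 (fun t => J *m M t - M t *m J).
Proof.
move=> p q; have [dpq|dpq] := eqVneq (d 0 (mode p)) (d 0 (mode q)).
  have dp0 : d 0 (mode p) != 0 by rewrite gt_eqF.
  apply: (isO_ext (isOM (isO_cst D h (d 0 (mode p))^-1) (isO_commutator p q))).
  move=> t _; rewrite !mxBE mul_diag_double -dpq.
  have -> : (J *m L *m M t) p q = d 0 (mode p) * (J *m M t) p q.
    rewrite -mulmxA; elim/ord_double_ind: p {dpq dp0} => j.
      by rewrite !Jmx_mull diag_double_mul !modeE.
    by rewrite !Jmx_mulr diag_double_mul !modeE mulrN.
  by rewrite [_ * d 0 _]mulrC -mulrBr mulKf.
have [OJM OMJ] := isO_offdiag_mulJ dpq.
by apply: isO_ext (isOB OJM OMJ) _ => t _; rewrite mxBE.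
Qed.

(** By [M^T J M = J] and [J^2 = - 1], the difference is
    [M^T (J M - M J) J]. *)
Lemma isO_gram : isOmx D h 1 (fun t => (M t)^T *m M t - 1%:M).
Proof.
have OF : isOmx D h 1 (fun t => (M t)^T *m (J *m M t - M t *m J) *m J).
  exact: (isOmx_mul h_ge0 (p := 1) (q := 0)
    (isOmx_mul h_ge0 (p := 0) (q := 1) (isOmx_tr transition_bounded) isO_commJ)
    (isOmx_cst D h _)).
apply: (isOmx_ext OF) => t /M_Sp; rewrite /Sp /= -/J; move: (M t) => N HM.
rewrite mulmxBr mulmxBl !mulmxA HM -[_ *m J *m J]mulmxA Jmx_sqr.
by rewrite mulmxN mulmx1 opprK addrC.
Qed.

Lemma mem_gamma x p : (p \in gamma A x) = (d 0 (mode p) == x).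
Proof.
rewrite !inE; elim/ord_double_ind: p => j; rewrite modeE.
  rewrite mem_imset ?inE; last exact: lshift_inj.
  case: imsetP => [[i _ /eqP]|_]; first by rewrite eq_lrshift.
  by rewrite orbF.
rewrite mem_imset ?inE; last exact: rshift_inj.
by case: imsetP => [[i _ /eqP]|_] //; rewrite eq_rlshift.
Qed.

(** The rows outside the class contribute entries of [M] that join different
    eigenvalues. *)
Lemma isO_class_gram x p q : p \in gamma A x -> q \in gamma A x ->
  isO D h 1 (fun t => \sum_(r in gamma A x) M t r p * M t r q - (p == q)%:R).
Proof.
rewrite !mem_gamma => /eqP dp /eqP dq.
have Ooff : isO D h 1
    (fun t => \sum_(r | r \notin gamma A x) M t r p * M t r q).
  apply: isO_sum => // r; rewrite mem_gamma => dr.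
  apply: (isOM (p := 1) (q := 0)); last exact: transition_bounded.
  by apply: isO_offdiag; rewrite dp.
apply: isO_ext (isOB (isO_gram p q) Ooff) _ => t _; rewrite mxBE.
move: (M t) => N; have -> : (N^T *m N) p q =
    \sum_(r in gamma A x) N r p * N r q
    + \sum_(r | r \notin gamma A x) N r p * N r q.
  rewrite mxE (bigID (fun r => r \in gamma A x)) /=.
  by congr (_ + _); apply: eq_bigr => r _; rewrite mxE.
by rewrite mxE addrAC addrK.
Qed.

(** A row outside the class contributes a product of two entries of [M] that
    both join different eigenvalues, which is where the second order comes from;
    the sum over all rows is exactly [J p q]. *)
Lemma isO_class_J x p q : p \in gamma A x -> q \in gamma A x ->
  isO D h 2 (fun t => \sum_(r in gamma A x) M t r p * (J *m M t) r q - J p q).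
Proof.
rewrite !mem_gamma => /eqP dp /eqP dq.
have Ooff : isO D h 2
    (fun t => \sum_(r | r \notin gamma A x) M t r p * (J *m M t) r q).
  apply: isO_sum => // r; rewrite mem_gamma => dr.
  apply: (isOM (p := 1) (q := 1)); first by apply: isO_offdiag; rewrite dp.
  by case: (@isO_offdiag_mulJ r q); rewrite ?dq.
apply: isO_ext (isON Ooff) _ => t Dt.
have := M_Sp Dt; rewrite /Sp /= -/J -mulmxA; move: (M t) => N.
move/matrixP/(_ p q) => <-; have -> : (N^T *m (J *m N)) p q =
    \sum_(r in gamma A x) N r p * (J *m N) r q
    + \sum_(r | r \notin gamma A x) N r p * (J *m N) r q.
  rewrite mxE (bigID (fun r => r \in gamma A x)) /=.
  by congr (_ + _); apply: eq_bigr => r _; rewrite [N^T _ _]mxE.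
by rewrite opprD addrA subrr add0r.
Qed.

End Perturbation.

Lemma bigO_pert_isOmx (R : realType) (n p m k : nat) (A : 'M[R]_(n + n))
    (Y : 'M[R]_(n + n) -> 'M[R]_(n + n) -> 'M[R]_(m, k)) :
  isOmx (admissible A) (@pert_size R n) p (fun t => Y t.1 t.2) ->
  bigO_pert A p Y.
Proof.
move/isOmx_specnorm => OY.
have [|c c0 [a a0 Ya]] := OY; first by move=> t; exact: specnorm_ge0.
exists c, a; split=> // H S' HS HA Ha S'A.
have := Ya (H, S') (And3 HS HA S'A) Ha.
by rewrite ger0_norm ?specnorm_ge0.
Qed.

(** * Blocks indexed by the modes of one eigenvalue *)

Lemma enum_ord_double n :
  enum 'I_(n + n) =
  map (@lshift n n) (enum 'I_n) ++ map (@rshift n n) (enum 'I_n).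
Proof.
apply: (inj_map val_inj); rewrite val_enum_ord map_cat iotaD add0n.
rewrite -(map_comp val (@lshift n n)) -(map_comp val (@rshift n n)).
congr (_ ++ _); first by rewrite -[LHS]val_enum_ord; apply: eq_map.
rewrite -[n in iota n _]addn0 iotaDl -[iota 0 n]val_enum_ord.
rewrite -(map_comp (addn n) val); exact: eq_map.
Qed.

Lemma enum_filter (T : finType) (B : {set T}) :
  enum B = [seq x <- enum T | x \in B].
Proof.
by rewrite {1}/enum_mem {1}/(enum _) -filter_predI; apply: eq_filter => x;
  rewrite /= andbT.
Qed.

Lemma lshift_alpha (R : realType) n (A : 'M[R]_(n + n)) x j :
  (lshift n j \in alpha A x) = (j \in eig_class A x).
Proof. by rewrite mem_imset //; exact: lshift_inj. Qed.

Lemma rshift_alpha (R : realType) n (A : 'M[R]_(n + n)) x j :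
  (rshift n j \in alpha A x) = false.
Proof. by apply/imsetP => -[i _ /eqP]; rewrite eq_rlshift. Qed.

Lemma rshift_beta (R : realType) n (A : 'M[R]_(n + n)) x j :
  (rshift n j \in beta A x) = (j \in eig_class A x).
Proof. by rewrite mem_imset //; exact: rshift_inj. Qed.

Lemma lshift_beta (R : realType) n (A : 'M[R]_(n + n)) x j :
  (lshift n j \in beta A x) = false.
Proof. by apply/imsetP => -[i _ /eqP]; rewrite eq_lrshift. Qed.

(** Every coordinate of a first half precedes every coordinate of a second half,
    so an increasing enumeration splits into the two halves. *)
Lemma enum_double (n : nat) (B : {set 'I_(n + n)}) :
  enum B = map (@lshift n n) (enum [set j | lshift n j \in B])
           ++ map (@rshift n n) (enum [set j | rshift n j \in B]).
Proof.
rewrite enum_filter enum_ord_double filter_cat.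
rewrite (filter_map (@lshift n n)) (filter_map (@rshift n n)) !enum_filter.
by congr (_ ++ _); congr map; apply: eq_filter => j /=; rewrite inE.
Qed.

Lemma enum_alpha (R : realType) n (A : 'M[R]_(n + n)) x :
  enum (alpha A x) = map (@lshift n n) (enum (eig_class A x)).
Proof.
have no_right : [set j | rshift n j \in alpha A x]%SET = finset.set0.
  by apply/setP => j; rewrite !inE rshift_alpha.
have left_eig : [set j | lshift n j \in alpha A x]%SET = eig_class A x.
  by apply/setP => j; rewrite inE lshift_alpha.
by rewrite enum_double no_right left_eig enum_set0 cats0.
Qed.

Lemma enum_beta (R : realType) n (A : 'M[R]_(n + n)) x :
  enum (beta A x) = map (@rshift n n) (enum (eig_class A x)).
Proof.
have no_left : [set j | lshift n j \in beta A x]%SET = finset.set0.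
  by apply/setP => j; rewrite !inE lshift_beta.
have right_eig : [set j | rshift n j \in beta A x]%SET = eig_class A x.
  by apply/setP => j; rewrite inE rshift_beta.
by rewrite enum_double no_left right_eig enum_set0.
Qed.

Lemma enum_gamma (R : realType) n (A : 'M[R]_(n + n)) x :
  enum (gamma A x) = enum (alpha A x) ++ enum (beta A x).
Proof.
rewrite enum_alpha enum_beta enum_double.
have -> : [set j | lshift n j \in gamma A x]%SET = eig_class A x.
  by apply/setP => j; rewrite inE finset.in_setU lshift_alpha lshift_beta orbF.
have -> : [set j | rshift n j \in gamma A x]%SET = eig_class A x.
  by apply/setP => j; rewrite inE finset.in_setU rshift_alpha rshift_beta.
by [].
Qed.

(** The [i]-th mode, in increasing order, of the eigenvalue [x]. The same
    enumeration serves [alpha] and [beta], and the first and second halves of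
    [gamma], which is what makes the retyped blocks compatible with [J]. *)
Definition class_idx (R : realType) n (A : 'M[R]_(n + n)) x
    (i : 'I_#|alpha A x|) : 'I_n := mode (enum_val i).

Lemma nth_eig_class (R : realType) n (A : 'M[R]_(n + n)) x
    (i : 'I_#|alpha A x|) j0 :
  nth j0 (enum (eig_class A x)) i = class_idx i.
Proof.
have i_lt : (i < size (enum (eig_class A x)))%N.
  by rewrite -(size_map (@lshift n n)) -enum_alpha -cardE.
rewrite /class_idx (enum_val_nth (lshift n j0)) enum_alpha.
by rewrite (nth_map j0) ?modeE.
Qed.

Lemma enum_val_alpha (R : realType) n (A : 'M[R]_(n + n)) x
    (i : 'I_#|alpha A x|) :
  enum_val i = lshift n (class_idx i).
Proof.
have i_lt : (i < size (enum (eig_class A x)))%N.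
  by rewrite -(size_map (@lshift n n)) -enum_alpha -cardE.
by rewrite (enum_val_nth (lshift n (class_idx i))) enum_alpha
  (nth_map (class_idx i)) // nth_eig_class.
Qed.

Lemma enum_val_beta (R : realType) n (A : 'M[R]_(n + n)) x
    (i : 'I_#|alpha A x|) :
  enum_val (cast_ord (esym (card_beta A x)) i) = rshift n (class_idx i).
Proof.
have i_lt : (i < size (enum (eig_class A x)))%N.
  by rewrite -(size_map (@lshift n n)) -enum_alpha -cardE.
by rewrite (enum_val_nth (rshift n (class_idx i))) enum_beta
  (nth_map (class_idx i)) // nth_eig_class.
Qed.

Definition gamma_idx (R : realType) n (A : 'M[R]_(n + n)) x
    (p : 'I_(#|alpha A x| + #|alpha A x|)) : 'I_(n + n) :=
  enum_val (cast_ord (esym (card_gamma A x)) p).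

Lemma gamma_idx_lshift (R : realType) n (A : 'M[R]_(n + n)) x
    (i : 'I_#|alpha A x|) :
  gamma_idx (lshift _ i) = lshift n (class_idx i).
Proof.
rewrite /gamma_idx (enum_val_nth (lshift n (class_idx i))) enum_gamma nth_cat.
rewrite -cardE /= ltn_ord -(enum_val_nth (lshift n (class_idx i))).
exact: enum_val_alpha.
Qed.

Lemma gamma_idx_rshift (R : realType) n (A : 'M[R]_(n + n)) x
    (i : 'I_#|alpha A x|) :
  gamma_idx (rshift _ i) = rshift n (class_idx i).
Proof.
rewrite /gamma_idx (enum_val_nth (rshift n (class_idx i))) enum_gamma nth_cat.
rewrite -cardE /= ltnNge leq_addr /= addKn -[RHS]enum_val_beta.
by rewrite (enum_val_nth (rshift n (class_idx i))).
Qed.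

Lemma gamma_idx_in (R : realType) n (A : 'M[R]_(n + n)) x p :
  @gamma_idx R n A x p \in gamma A x.
Proof. exact: enum_valP. Qed.

Lemma gamma_idx_inj (R : realType) n (A : 'M[R]_(n + n)) x :
  injective (@gamma_idx R n A x).
Proof. by move=> p q /enum_val_inj/cast_ord_inj. Qed.

Lemma sum_gamma_idx (R : realType) n (A : 'M[R]_(n + n)) x
    (F : 'I_(n + n) -> R) :
  \sum_p F (@gamma_idx R n A x p) = \sum_(r in gamma A x) F r.
Proof.
rewrite [RHS]big_enum_val /= [RHS](reindex_onto
  (cast_ord (esym (card_gamma A x))) (cast_ord (card_gamma A x))) /=.
  by apply: eq_bigl => p; rewrite cast_ordKV eqxx.
by move=> i _; rewrite cast_ordK.
Qed.

Lemma sub_ggE (R : realType) n (A M : 'M[R]_(n + n)) x p q :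
  sub_gg A M x p q = M (gamma_idx p) (gamma_idx q).
Proof. by rewrite castmxE mxE. Qed.

(** Restriction to a set of complete symplectic pairs commutes with [J]. *)
Lemma Jmx_sub_gg (R : realType) n (A M : 'M[R]_(n + n)) x p q :
  (Jmx R #|alpha A x| *m sub_gg A M x) p q =
  (Jmx R n *m M) (gamma_idx p) (gamma_idx q).
Proof.
elim/ord_double_ind: p => i.
  by rewrite Jmx_mull sub_ggE gamma_idx_lshift gamma_idx_rshift Jmx_mull.
by rewrite Jmx_mulr sub_ggE gamma_idx_lshift gamma_idx_rshift Jmx_mulr.
Qed.

Lemma Jmx_gamma_idx (R : realType) n (A : 'M[R]_(n + n)) x p q :
  Jmx R #|alpha A x| p q = Jmx R n (@gamma_idx R n A x p) (gamma_idx q).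
Proof.
have sub1 : sub_gg A 1%:M x = 1%:M.
  apply/matrixP => a b; rewrite sub_ggE !mxE.
  by rewrite (inj_eq (@gamma_idx_inj _ _ _ _)).
by rewrite -[Jmx R #|_|]mulmx1 -[Jmx R n]mulmx1 -sub1 Jmx_sub_gg.
Qed.

Theorem proposition5 (R : realType) (n : nat) (A : 'M[R]_(n + n))
    (r : nat) (mu : r.-tuple R) (S : 'M[R]_(n + n))
    (hA : Pd A)
    (mu_incr : forall i j : 'I_r, (i < j)%N -> tnth mu i < tnth mu j)
    (mu_eigs : forall x : R,
       (exists i : 'I_r, tnth mu i = x) <->
       (exists j : 'I_n, symp_eigs A 0 j = x))
    (hS : SpA A S) :
  (forall i j : 'I_r, i <> j ->
     bigO_pert A 1 (fun H S' =>
       submatrix (invmx S *m S') (gamma A (tnth mu i)) (gamma A (tnth mu j))))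
  /\
  (forall i : 'I_r,
     [/\ bigO_pert A 1 (fun H S' =>
           sub_aa A (invmx S *m S') (tnth mu i)
           - sub_bb A (invmx S *m S') (tnth mu i)),
         bigO_pert A 1 (fun H S' =>
           sub_ab A (invmx S *m S') (tnth mu i)
           - - sub_ba A (invmx S *m S') (tnth mu i)),
         bigO_pert A 1 (fun H S' =>
           (sub_gg A (invmx S *m S') (tnth mu i))^T
             *m sub_gg A (invmx S *m S') (tnth mu i)
           - 1%:M) &
         bigO_pert A 2 (fun H S' =>
           (sub_gg A (invmx S *m S') (tnth mu i))^T
             *m Jmx R #|alpha A (tnth mu i)|
             *m sub_gg A (invmx S *m S') (tnth mu i)
           - Jmx R #|alpha A (tnth mu i)|)]).
Proof.
split=> [i j ij|i].
  apply: bigO_pert_isOmx => a b.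
  have := @isO_offdiag R n A S hA hS (enum_val a) (enum_val b).
  have /eqP -> : symp_eigs A 0 (mode (enum_val a)) == tnth mu i.
    by rewrite -mem_gamma enum_valP.
  have /eqP -> : symp_eigs A 0 (mode (enum_val b)) == tnth mu j.
    by rewrite -mem_gamma enum_valP.
  have mu_ij : tnth mu i != tnth mu j.
    apply/eqP => mu_eq.
    have [lt_ij|lt_ji|eq_ij] := ltngtP i j.
    - by have := mu_incr _ _ lt_ij; rewrite mu_eq ltxx.
    - by have := mu_incr _ _ lt_ji; rewrite mu_eq ltxx.
    - by apply: ij; exact: val_inj.
  by move=> /(_ mu_ij) /isO_ext; apply=> t _; rewrite mxE.
have OC := isO_commJ hA hS.
split; apply: bigO_pert_isOmx => a b.
- have O_ab := OC (lshift n (class_idx a)) (rshift n (class_idx b)).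
  apply: (isO_ext (isON O_ab)) => t _; rewrite !mxBE Jmx_mull mul_Jmxr.
  rewrite /sub_aa /sub_bb castmxE /submatrix.
  by rewrite ![mxsub _ _ _ _ _]mxE !enum_val_alpha !enum_val_beta opprB.
- apply: (isO_ext (OC (lshift n (class_idx a)) (lshift n (class_idx b)))).
  move=> t _; rewrite !mxBE Jmx_mull mul_Jmxl opprK /sub_ab /sub_ba /submatrix.
  rewrite [(- castmx _ _) _ _]mxE !castmxE /=.
  rewrite ![mxsub _ _ _ _ _]mxE !cast_ord_id !enum_val_alpha !enum_val_beta.
  by rewrite opprK addrC.
- apply: (isO_ext (isO_class_gram hA hS
    (@gamma_idx_in R n A _ a) (@gamma_idx_in R n A _ b))) => t _.
  rewrite mxBE mxE [1%:M _ _]mxE (inj_eq (@gamma_idx_inj _ _ _ _)).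
  rewrite -sum_gamma_idx; congr (_ - _); apply: eq_bigr => p _.
  by rewrite [(_^T) _ _]mxE !sub_ggE.
- apply: (isO_ext (isO_class_J hA hS
    (@gamma_idx_in R n A _ a) (@gamma_idx_in R n A _ b))) => t _.
  rewrite mxBE -mulmxA mxE Jmx_gamma_idx.
  rewrite -sum_gamma_idx; congr (_ - _); apply: eq_bigr => p _.
  by rewrite [(_^T) _ _]mxE sub_ggE Jmx_sub_gg.
Qed.
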